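(* There exists an absolute constant $c>0$ such that the following holds. For all $\delta\in(0,1]$ and all $q\in[0,1]$ there exist $n_0\in\mathbb{N}$ and $\varepsilon_0>0$ such that for every $\varepsilon\in(0,\varepsilon_0)$, every $n\ge n_0$ and every $\ell\ge \delta/\varepsilon$, with $p=\frac{1+\varepsilon}{n}$: any adaptive algorithm which reveals a path of length $\ell$ in $G\sim G(n,p)$ with probability at least $q$ must query at least $c\,\frac{q\ell\delta}{p\varepsilon}$ pairs of vertices. Equivalently, no adaptive algorithm querying at most $c\,\frac{q\ell\delta}{p\varepsilon}$ pairs reveals a path of length $\ell$ in $G$ with probability at least $q$.
   Context: $G(n,p)$ is the Erdős–Rényi random graph on vertex set $[n]$, each pair being an edge independently with probability $p$. $G$ is hidden. An adaptive algorithm sequentially queries pairs $\{u,v\}$ of vertices and learns whether $uv$ is an edge of $G$; each query may depend on the outcomes of all previous queries. The algorithm reveals a path of length $\ell$ if the queried pairs that turned out to be edges of $G$ contain a path of length $\ell$. A path of length $m$ has $m$ vertices and $m-1$ edges. *)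

(* Defs.v *)
From HB Require Import structures.
From mathcomp Require Import all_boot all_order all_algebra.
From mathcomp Require Import reals.

Set Implicit Arguments.
Unset Strict Implicit.
Unset Printing Implicit Defensive.

Import Order.TTheory GRing.Theory Num.Theory.
Local Open Scope ring_scope.

Definition vpair (n : nat) := {e : {set 'I_n} | #|e| == 2}.

(* A graph on 'I_n is its set of edges; this type is the sample space of
   G(n,p), and also the type of the revealed subgraphs. *)
Notation graph n := {set vpair n}.

Definition adj (n : nat) (G : graph n) : rel 'I_n :=
  fun u v => [exists e in G, val e == [set u; v]].

(* l counts the vertices of the path, so it has l - 1 edges. *)
Definition has_path (n : nat) (G : graph n) (l : nat) : bool :=
  [exists s : l.-tuple 'I_n, uniq s && sorted (adj G) s].

Definition gnp (R : realType) (n : nat) (p : R) (G : graph n) : R :=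
  \prod_(e : vpair n) (if e \in G then p else 1 - p).

(* A deterministic adaptive algorithm is a decision tree: in [Query e t1 t0]
   the run continues with t1 if e is an edge of the hidden graph, and with t0
   otherwise. *)
Inductive strategy (n : nat) : Type :=
| Stop
| Query of vpair n & strategy n & strategy n.

Fixpoint queried (n : nat) (t : strategy n) (G : graph n) : {set vpair n} :=
  match t with
  | Stop => set0
  | Query e t1 t0 => e |: queried (if e \in G then t1 else t0) G
  end.

Definition revealed (n : nat) (t : strategy n) (G : graph n) : graph n :=
  queried t G :&: G.

(* The algorithm may use internal randomness, in the form of a random seed
   independent of the hidden graph. Finitely many seeds lose no generality:
   only finitely many maps G |-> queried t G exist for a given n.
   Deterministic algorithms are those with a single seed. *)
Record algorithm (R : realType) (n : nat) := Algorithm {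
  seed : finType;
  seed_law : seed -> R;
  seed_law_ge0 : forall s, 0 <= seed_law s;
  seed_law_sum1 : \sum_s seed_law s = 1;
  strategy_of : seed -> strategy n
}.

(* The probability is over the seed and G ~ G(n,p), independent. *)
Definition prob_reveals_path (R : realType) (n : nat) (p : R)
    (A : algorithm R n) (l : nat) : R :=
  \sum_(s : seed A) \sum_(G : graph n | has_path (revealed (strategy_of s) G) l)
    seed_law s * gnp p G.

(* Worst case over the hidden graph and the seeds of positive probability;
   a pair queried several times is counted once. *)
Definition num_queries (R : realType) (n : nat) (A : algorithm R n) : nat :=
  \max_(s : seed A | 0 < seed_law s)
    \max_(G : graph n) #|queried (strategy_of s) G|.

(* Main.v *)
(* Say that v has two k-arms if two edge-disjoint paths with k edges start at v,
   and take k of order delta/eps. A revealed path with l >= 4k vertices contains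
   at least l/2 vertices with two k-arms in the revealed graph, so it suffices to
   bound the expected number of these by O(p/k) times the number of queries.
   Up to depth k the graph G(n,p) is essentially critical: exposing the edges at
   v gives a recursion showing that v has a k-arm with probability O(1/k), and by
   the BK inequality it has two with probability O(1/k^2). When it does, only the
   2k edges of a witness can be pivotal for this event, so that, averaging over
   all pairs e, the expected number of v for which e is open and pivotal is
   O(1/(kn)) = O(p/k). As in the O'Donnell-Saks-Schramm-Servedio inequality,
   resampling the pairs one by one as they are queried bounds the covariance of
   "v has two arms in the revealed graph" and "v has two arms in G", summed over
   v, by the number of queries times this influence. Since the first event
   implies the second, which is unlikely, the covariance is at least half the
   probability of the first event. *)

Require Import Defs.
From HB Require Import structures.
From mathcomp Require Import all_boot all_order all_algebra.
From mathcomp Require Import fingroup perm.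
From mathcomp Require Import reals.
From mathcomp Require Import ring lra zify.

Set Implicit Arguments.
Unset Strict Implicit.
Unset Printing Implicit Defensive.

Import Order.TTheory GRing.Theory Num.Theory.
Local Open Scope ring_scope.

(** * The Bernoulli product measure on the subsets of a finite type *)

Section Expectation.
Variables (R : realFieldType) (T : finType) (p : R).
Hypotheses (p_ge0 : 0 <= p) (p_le1 : p <= 1).
Implicit Types (G S : {set T}) (f g : {set T} -> R).

(** For [T] the type of vertex pairs this is [gnp]. *)
Definition ber G : R := \prod_e (if e \in G then p else 1 - p).

Definition expect f : R := \sum_G ber G * f G.

Lemma ber_ge0 G : 0 <= ber G.
Proof. by apply: prodr_ge0 => e _; case: ifP => _; rewrite ?subr_ge0. Qed.

Lemma sum_ber : \sum_G ber G = 1.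
Proof.
rewrite -(@bigA_distr _ _ _ _ _ _ (fun=> p) (fun=> 1 - p)) big1 // => e _.
by rewrite /= addrCA subrr addr0.
Qed.

Lemma eq_expect f g : f =1 g -> expect f = expect g.
Proof. by move=> fg; apply: eq_bigr => G _; rewrite fg. Qed.

Lemma ler_expect f g : (forall G, f G <= g G) -> expect f <= expect g.
Proof. by move=> fg; apply: ler_sum => G _; rewrite ler_wpM2l ?ber_ge0. Qed.

Lemma expect_cst c : expect (fun=> c) = c.
Proof. by rewrite /expect -mulr_suml sum_ber mul1r. Qed.

Lemma expectD f g : expect (fun G => f G + g G) = expect f + expect g.
Proof. by rewrite -big_split; apply: eq_bigr => G _; rewrite mulrDr. Qed.

Lemma expectZ c f : expect (fun G => c * f G) = c * expect f.
Proof. by rewrite mulr_sumr; apply: eq_bigr => G _; rewrite mulrCA. Qed.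

Lemma expect_sum (I : Type) (r : seq I) (P : pred I) (F : I -> {set T} -> R) :
  expect (fun G => \sum_(i <- r | P i) F i G) =
  \sum_(i <- r | P i) expect (F i).
Proof. by rewrite exchange_big; apply: eq_bigr => G _; rewrite mulr_sumr. Qed.

Lemma expect_ge0 f : (forall G, 0 <= f G) -> 0 <= expect f.
Proof. by move=> f0; rewrite -(expect_cst 0); apply: ler_expect. Qed.

Lemma sum_set_split (e : T) f :
  \sum_G f G = \sum_(G : {set T} | e \notin G) (f (e |: G) + f G).
Proof.
rewrite (bigID (fun G : {set T} => e \in G)) big_split /=; congr (_ + _).
rewrite (reindex_onto (fun G => e |: G) (fun G => G :\ e)) /=; last first.
  by move=> G eG; rewrite setD1K.
apply: eq_bigl => G; rewrite setU11 /=; apply/eqP/idP => [<-|eG].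
  by rewrite setD11.
by rewrite setU1K.
Qed.

(** Conditioning on the coin of [e]; the outer expectation still runs over all coordinates, so that
    both sides remain of the form [expect] and can be compared pointwise. *)
Lemma expect_split (e : T) f :
  expect f = expect (fun G => p * f (e |: G) + (1 - p) * f (G :\ e)).
Proof.
have berE G : ber G = (if e \in G then p else 1 - p) *
    \prod_(x | x != e) (if x \in G then p else 1 - p).
  by rewrite /ber (bigD1 e).
rewrite /expect !(sum_set_split e); apply: eq_bigr => G eG.
have GDe : G :\ e = G by apply/setDidPl; rewrite disjoint_sym disjoints1.
rewrite !berE setU11 (negbTE eG) setUA setUid setU1K // GDe.
rewrite (eq_bigr (fun x => if x \in G then p else 1 - p)) => [|x /negbTE xe].
  by ring.
by rewrite !inE xe.
Qed.

Lemma expect_reindex (h : T -> T) f :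
  bijective h -> expect f = expect (fun G => f (h @: G)).
Proof.
move=> hbij; have hinj := bij_inj hbij.
rewrite /expect (reindex (fun G => h @: G)) /=; last first.
  case: hbij => h' hK h'K; exists (fun G => h' @: G) => G _;
  by rewrite -imset_comp -[RHS]imset_id; apply: eq_imset => x /=.
apply: eq_bigr => G _; congr (_ * _).
rewrite /ber (reindex h) /=; last exact: onW_bij.
by apply: eq_bigr => x _; rewrite mem_imset.
Qed.

End Expectation.

(** * The BK inequality, by doubling coordinates one at a time *)

(** [b1], [b0] record an event with a coin up or down, and the [c] bits the event once the coin is
    replaced by two independent ones. If the event needs the coin, it needs only one of the two
    copies, so its conditional probability stays at least [p]. *)
Lemma coin_doubling (R : realFieldType) (p : R) (b1 b0 c11 c10 c01 c00 : bool) :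
  0 <= p -> p <= 1 ->
  (b0 -> [&& c11, c10, c01 & c00]) -> (b1 -> b0 || c11 && (c10 || c01)) ->
  p * b1%:R + (1 - p) * b0%:R <=
  p * (p * c11%:R + (1 - p) * c10%:R) +
  (1 - p) * (p * c01%:R + (1 - p) * c00%:R).
Proof.
move=> p0 p1.
case: b0; case: b1; case: c11; case: c10; case: c01; case: c00 => //= H1 H2;
  by [move: (H1 isT) | move: (H2 isT) | nra].
Qed.

Section BK.
Variables (R : realFieldType) (T : finType) (p : R).
Hypotheses (p_ge0 : 0 <= p) (p_le1 : p <= 1).
Implicit Types (G S W : {set T}) (A B : {set T} -> bool).

Definition increasing A := forall G G', G \subset G' -> A G -> A G'.

Definition disjoint_occurrence A B G :=
  [exists W1 : {set T}, [exists W2 : {set T},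
    [&& [disjoint W1 & W2], W1 \subset G, W2 \subset G, A W1 & B W2]]].

(* The coordinates in [S] have been doubled: [A] reads them in [G], and [B] in
   [G'], so that the witnesses may share them. *)
Let split_occurrence A B S G G' :=
  [exists W1 : {set T}, [exists W2 : {set T},
    [&& W1 :&: W2 \subset S, W1 \subset G,
        W2 \subset (G :\: S) :|: (G' :&: S), A W1 & B W2]]].

(** As [e] is not in [S], at most one of the two witnesses uses [e], so giving [B] its own copy of
    that coin cannot hurt. *)
Lemma split_occurrence_mono A B S e G G' :
  e \notin S ->
  p * (split_occurrence A B S (e |: G) G')%:R +
    (1 - p) * (split_occurrence A B S (G :\ e) G')%:R <=
  p * (p * (split_occurrence A B (e |: S) (e |: G) (e |: G'))%:R +
       (1 - p) * (split_occurrence A B (e |: S) (e |: G) (G' :\ e))%:R) +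
  (1 - p) *
      (p * (split_occurrence A B (e |: S) (G :\ e) (e |: G'))%:R +
       (1 - p) * (split_occurrence A B (e |: S) (G :\ e) (G' :\ e))%:R) :> R.
Proof.
move=> eS.
have useP (W1 W2 K K' : {set T}) : W1 :&: W2 \subset S -> A W1 -> B W2 ->
    W1 \subset K -> W2 \subset (K :\: (e |: S)) :|: (K' :&: (e |: S)) ->
    split_occurrence A B (e |: S) K K'.
  move=> W12 AW BW sK sK'; apply/existsP; exists W1; apply/existsP; exists W2.
  by rewrite AW BW sK sK' (subset_trans W12) // subsetUr.
apply: coin_doubling => // [|/existsP[W1 /existsP[W2 /and5P[W12 s1 s2 AW BW]]]].
  move=> /existsP[W1 /existsP[W2 /and5P[W12 s1 s2 AW BW]]].
  have occ (K K' : {set T}) : K = e |: G \/ K = G :\ e -> K' = e |: G' \/ K' = G' :\ e ->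
      split_occurrence A B (e |: S) K K'.
    move=> KE KE'; apply: (useP W1 W2) => //.
      apply: (subset_trans s1); apply/subsetP => x; rewrite !inE.
      by case: KE => ->; rewrite !inE; case: (x \in G); rewrite ?orbT ?andbT ?andbF.
    apply: (subset_trans s2); apply/subsetP => x.
    by case: KE => ->; case: KE' => ->; rewrite !inE;
       case: (eqVneq x e) => [->|_] /=; rewrite ?eqxx ?(negbTE eS) ?andbF ?orbF.
  by rewrite !occ //; auto.
case: (boolP (split_occurrence A B S (G :\ e) G')) => //= no0.
have e12 : (e \in W1) && (e \in W2) = false.
  by apply/negbTE/negP => eW; move/subsetP/(_ e): W12; rewrite inE eW (negbTE eS) => /(_ isT).
(* If [W1] uses [e], the copy in [G'] is free; if [W2] does, the copy in [G] is free; if neither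
   does, the event already occurs at [G :\ e], contrary to [no0]. *)
case: (boolP (e \in W1)) e12 => [eW1|eW1] /= eW2.
  have occ (K' : {set T}) : K' = e |: G' \/ K' = G' :\ e ->
      split_occurrence A B (e |: S) (e |: G) K'.
    move=> KE; apply: (useP W1 W2) => //.
    apply/subsetP => x xW; have xe : x != e by apply: contraFneq eW2 => <-.
    move/subsetP/(_ _ xW): s2; case: KE => ->; rewrite !inE (negbTE xe) /=;
    by rewrite ?andbT.
  by rewrite !occ //; auto.
have [eW2'|eW2'] := boolP (e \in W2); last first.
  case/negP: no0; apply/existsP; exists W1; apply/existsP; exists W2.
  rewrite W12 AW BW !andbT /=; apply/andP; split; apply/subsetP => x xW.
    have xe : x != e by apply: contraNneq eW1 => <-.
    by move/subsetP/(_ _ xW): s1; rewrite !inE (negbTE xe).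
  have xe : x != e by apply: contraNneq eW2' => <-.
  by move/subsetP/(_ _ xW): s2; rewrite !inE (negbTE xe).
have occ (K : {set T}) : K = e |: G \/ K = G :\ e ->
    split_occurrence A B (e |: S) K (e |: G').
  move=> KE; apply: (useP W1 W2) => //; apply/subsetP => x xW.
    have xe : x != e by apply: contraNneq eW1 => <-.
    by move/subsetP/(_ _ xW): s1; case: KE => ->; rewrite !inE (negbTE xe).
  move/subsetP/(_ _ xW): s2; case: KE => ->; rewrite !inE;
  by case: eqVneq => //= _; rewrite ?orbT.
by rewrite !occ ?orbT //; auto.
Qed.

(** [Pr] interpolates between [S = set0], where disjoint witnesses are sought in one configuration,
    and [S = setT], where [A] and [B] read independent configurations; it grows with every
    coordinate added to [S]. *)
Lemma BK_inequality A B : increasing A -> increasing B ->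
  expect p (fun G => (disjoint_occurrence A B G)%:R) <=
  expect p (fun G => (A G)%:R) * expect p (fun G => (B G)%:R) :> R.
Proof.
move=> incA incB.
pose Pr S : R := expect p (fun G =>
  expect p (fun G' => (split_occurrence A B S G G')%:R)).
have PrU e S : e \notin S -> Pr S <= Pr (e |: S).
  move=> eS; rewrite /Pr.
  rewrite (expect_split _ e) [leRHS](expect_split _ e).
  apply: ler_expect => // G.
  rewrite (expect_split _ e (fun G' => (split_occurrence A B (e |: S) (e |: G) G')%:R)).
  rewrite (expect_split _ e (fun G' => (split_occurrence A B (e |: S) (G :\ e) G')%:R)).
  rewrite -!expectZ -!expectD; apply: ler_expect => // G'.
  exact: split_occurrence_mono.
have Pr_seq (s : seq T) : Pr set0 <= Pr [set:: s].
  elim: s => [|e s IH]; first by rewrite set_nil.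
  rewrite set_cons; case: (boolP (e \in [set:: s])) => [es|es].
    by rewrite (setUidPr _) // sub1set.
  exact: le_trans IH (PrU _ _ es).
have Pr0T : Pr set0 <= Pr setT by rewrite -(set_enum setT); apply: Pr_seq.
apply: (le_trans (le_trans _ Pr0T)).
  apply: ler_expect => // G; rewrite -[leLHS](expect_cst T p).
  apply: ler_expect => // G'; rewrite ler_nat.
  case: (boolP (disjoint_occurrence A B G)) => //.
  move=> /existsP[W1 /existsP[W2 /and5P[W12 s1 s2 AW BW]]].
  suff -> : split_occurrence A B set0 G G' by [].
  apply/existsP; exists W1; apply/existsP; exists W2.
  by rewrite subset0 setI_eq0 W12 s1 AW BW setD0 setI0 setU0 s2.
(* At [setT] the witnesses lie in [G] and [G'] respectively, and monotonicity gives [A G] and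
   [B G']. *)
rewrite mulrC -expectZ; apply: ler_expect => // G.
rewrite mulrC -expectZ; apply: ler_expect => // G'.
case: (boolP (split_occurrence A B setT G G')) => [|_]; last first.
  by rewrite mulr_ge0.
move=> /existsP[W1 /existsP[W2 /and5P[_ s1 s2 AW BW]]].
rewrite (incA _ _ s1 AW) (incB _ _ _ BW) ?mulr1 //.
by apply: subset_trans s2 _; rewrite setDT set0U setIT.
Qed.

End BK.

(** * Independent coordinates, arms, witnesses and pivotal elements *)

Definition independent_of (T : finType) (V : Type) (x : T) (f : {set T} -> V) :=
  forall G, f (x |: G) = f (G :\ x).

(** Given the coordinates outside [s], the indicators of [e \in G] are independent coins of mean
    [p]. The factor [psi] lets the induction absorb the head of [s] while the tail is averaged. *)
Lemma expect_prod_independent (R : realFieldType) (T : finType) (p : R)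
    (s : seq T) (a : T -> {set T} -> bool) (psi : {set T} -> R) :
  uniq s ->
  {in s &, forall x e, independent_of x (a e)} ->
  {in s, forall x, independent_of x psi} ->
  expect p (fun G => \prod_(e <- s) (1 - ((e \in G) && a e G)%:R) * psi G) =
  expect p (fun G => \prod_(e <- s) (1 - p * (a e G)%:R) * psi G).
Proof.
elim: s psi => [|e s IH] psi /= => [_ _ _|/andP[es us] inda indpsi].
  by apply: eq_expect => G; rewrite !big_nil.
have inda' : {in s &, forall x e, independent_of x (a e)}.
  by move=> x y xs ys; apply: inda; rewrite inE (xs, ys) orbT.
transitivity (expect p (fun G => \prod_(e <- s) (1 - p * (a e G)%:R) *
    ((1 - ((e \in G) && a e G)%:R) * psi G))).
  rewrite -IH // => [|x xs G].
    by apply: eq_expect => G; rewrite big_cons mulrAC mulrC mulrA.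
  have ex : (e == x) = false by apply: contraNF es => /eqP->.
  by rewrite !inE ex /= inda ?indpsi // inE ?eqxx // xs orbT.
rewrite (expect_split _ e) [RHS](expect_split _ e); apply: eq_expect => G.
have prodE : \prod_(x <- s) (1 - p * (a x (e |: G))%:R) =
    \prod_(x <- s) (1 - p * (a x (G :\ e))%:R) :> R.
  by apply: eq_big_seq => x xs; rewrite inda // inE ?eqxx // xs orbT.
rewrite !big_cons prodE indpsi ?inda ?inE ?eqxx //=.
by case: (a e (G :\ e)) => /=; ring.
Qed.

(** Here [k] counts edges, as [s] omits the starting vertex; in [has_path] the length counts
    vertices. *)
Definition arm (n : nat) (v : 'I_n) (k : nat) (G : graph n) : bool :=
  [exists s : k.-tuple 'I_n, uniq (v :: s) && path (adj G) v s].

Definition star (n : nat) (v : 'I_n) : {set vpair n} := [set e : vpair n | v \in val e].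

Lemma adjS (n : nat) (G G' : graph n) (u v : 'I_n) :
  G \subset G' -> adj G u v -> adj G' u v.
Proof.
move=> GG' /existsP[e /andP[eG euv]]; apply/existsP; exists e.
by rewrite (subsetP GG').
Qed.

Lemma arm_increasing (n : nat) (v : 'I_n) (k : nat) : increasing (arm v k).
Proof.
move=> G G' GG' /existsP[s /andP[us ps]]; apply/existsP; exists s.
by rewrite us (sub_path _ ps) // => x y; apply: adjS.
Qed.

(** The remainder of the arm avoids [v], hence uses no pair at [v]: this makes it independent of the
    first edge. *)
Lemma arm_recl (n : nat) (v : 'I_n) (k : nat) (G : graph n) :
  arm v k.+1 G ->
  exists (e : vpair n) (u : 'I_n), [/\ e \in G, val e = [set v; u] & arm u k (G :\: star v)].
Proof.
move=> /existsP[s]; case/tupleP: s => u s /= /andP[/andP[vus uus]].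
move=> /andP[/existsP[e /andP[eG /eqP euv]] ps]; exists e, u; split=> //.
apply/existsP; exists s; rewrite /= uus /=.
apply: (@sub_in_path _ (mem (u :: s)) (adj G)) ps; last by apply/allP.
move=> x y xs ys /existsP[e' /andP[eG' /eqP exy]].
apply/existsP; exists e'; rewrite exy eqxx andbT inE eG' andbT inE exy !inE.
by apply/norP; split; apply: contraNneq vus => ->.
Qed.

Lemma path_support (n : nat) (G : graph n) (v : 'I_n) (s : seq 'I_n) :
  path (adj G) v s ->
  exists W : graph n, [/\ W \subset G, (#|W| <= size s)%N & path (adj W) v s].
Proof.
elim: s v => [|u s IH] v /=; first by exists set0; rewrite sub0set cards0.
move=> /andP[/existsP[e /andP[eG euv]] /IH[W [WG Ws ps]]].
exists (e |: W); split; first by rewrite subUset sub1set eG.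
  by rewrite cardsU1; case: (_ \notin _); rewrite ?add1n ?add0n ?ltnS // ltnW.
apply/andP; split; first by apply/existsP; exists e; rewrite setU11.
by apply: sub_path ps => x y; apply: adjS; apply: subsetUr.
Qed.

Lemma arm_support (n : nat) (v : 'I_n) (k : nat) (G : graph n) :
  arm v k G ->
  exists W : graph n, [/\ W \subset G, (#|W| <= k)%N & arm v k W].
Proof.
move=> /existsP[s /andP[us /path_support[W [WG Ws ps]]]].
exists W; split=> //; first by rewrite size_tuple in Ws.
by apply/existsP; exists s; rewrite us.
Qed.

Lemma disjoint_occurrence_increasing (T : finType) (A B : {set T} -> bool) :
  increasing (disjoint_occurrence A B).
Proof.
move=> G G' GG' /existsP[W1 /existsP[W2 /and5P[W12 s1 s2 AW BW]]].
apply/existsP; exists W1; apply/existsP; exists W2.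
by rewrite W12 AW BW (subset_trans s1) ?(subset_trans s2).
Qed.

Lemma disjoint_occurrence_support (T : finType) (A B : {set T} -> bool)
    (a b : nat) (G : {set T}) :
  (forall G, A G -> exists W : {set T}, [/\ W \subset G, (#|W| <= a)%N & A W]) ->
  (forall G, B G -> exists W : {set T}, [/\ W \subset G, (#|W| <= b)%N & B W]) ->
  disjoint_occurrence A B G ->
  exists W : {set T}, [/\ W \subset G, (#|W| <= a + b)%N &
    disjoint_occurrence A B W].
Proof.
move=> suppA suppB /existsP[W1 /existsP[W2 /and5P[W12 s1 s2]]].
move=> /suppA[W1' [s1' c1 AW]] /suppB[W2' [s2' c2 BW]].
exists (W1' :|: W2'); split.
- by rewrite subUset (subset_trans s1') ?(subset_trans s2').
- by rewrite cardsU (leq_trans (leq_subr _ _)) // leq_add.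
- apply/existsP; exists W1'; apply/existsP; exists W2'.
  rewrite AW BW subsetUl subsetUr !andbT /=.
  exact: disjointWl s1' (disjointWr s2' W12).
Qed.

(** Deleting an element outside a fixed witness leaves the witness intact, so all pivotal elements
    lie in one set of size at most [m]. *)
Lemma sum_pivotal_le (R : realFieldType) (T : finType) (A : {set T} -> bool)
    (m : nat) (G : {set T}) :
  increasing A ->
  (A G -> exists W : {set T}, [/\ W \subset G, (#|W| <= m)%N & A W]) ->
  \sum_e (e \in G)%:R * ((A G)%:R - (A (G :\ e))%:R) <= m%:R * (A G)%:R :> R.
Proof.
move=> incA supp; case: (boolP (A G)) => [/supp[W [WG Wm AW]]|AG] /=; last first.
  rewrite mulr0 sumr_le0 // => e _; rewrite mulr_ge0_le0 // sub0r oppr_le0.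
  exact: ler0n.
rewrite mulr1; apply: (@le_trans _ _ (#|W|%:R)); last by rewrite ler_nat.
rewrite -sum1_card natr_sum [leRHS]big_mkcond; apply: ler_sum => e _ /=.
case: (boolP (e \in W)) => eW.
  by case: (e \in G); case: (A (G :\ e)); rewrite ?mul1r ?mul0r ?subrr ?subr0.
suff -> : A (G :\ e) by rewrite subrr mulr0.
by apply: incA AW; rewrite subsetD1 WG.
Qed.

Definition two_arms (n : nat) (k : nat) (v : 'I_n) : graph n -> bool :=
  disjoint_occurrence (arm v k) (arm v k).

(** * One-arm and two-arm probabilities *)

(** The factor 1/4, half of the binomial coefficient's 1/2, leaves the slack
    [p ^+ 2 * x * (2 - p * x + p) / 4] that closes the induction. *)
Lemma expr_bernoulli2 (R : realFieldType) (p : R) (x : nat) :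
  0 <= p <= 1 -> p * x%:R <= 2 ->
  1 - p * x%:R + p ^+ 2 * x%:R * (x%:R - 1) / 4 <= (1 - p) ^+ x.
Proof.
move=> /andP[p0 p1]; elim: x => [|x IH] px.
  by rewrite expr0 !mulr0 mul0r mul0r subr0 addr0.
have x0 : 0 <= x%:R :> R by rewrite ler0n.
have px' : p * x%:R <= 2 by move: px; rewrite -natr1; nra.
move: (IH px') => {}IH.
apply: (@le_trans _ _ ((1 - p) * (1 - p * x%:R + p ^+ 2 * x%:R * (x%:R - 1) / 4))).
  rewrite -natr1 -subr_ge0.
  have -> : (1 - p) * (1 - p * x%:R + p ^+ 2 * x%:R * (x%:R - 1) / 4) -
    (1 - p * (x%:R + 1) + p ^+ 2 * (x%:R + 1) * (x%:R + 1 - 1) / 4) =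
    p ^+ 2 * x%:R * (2 - p * x%:R + p) / 4 by field.
  rewrite !mulr_ge0 ?exprn_ge0 ?invr_ge0 //; lra.
by rewrite [leRHS]exprS; apply: ler_wpM2l => //; rewrite subr_ge0.
Qed.

(* In y = p x, the right-hand side is the tangent at y = b of the concave
   parabola y - y^2/4 + p y/4, so its expectation is linear in that of x. *)
Lemma one_sub_expr_le (R : realFieldType) (p b : R) (x : nat) :
  0 <= p <= 1 -> p * x%:R <= 2 ->
  1 - (1 - p) ^+ x <= b ^+ 2 / 4 + (1 + p / 4 - b / 2) * p * x%:R.
Proof.
move=> p01 px; have := expr_bernoulli2 p01 px.
have := sqr_ge0 (p * x%:R - b).
move: ((1 - p) ^+ x) (x%:R) => y z; lra.
Qed.

Lemma prod_exp_count (R : comPzRingType) (T : Type) (a : pred T) (x : R)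
    (s : seq T) :
  \prod_(e <- s) (1 - x * (a e)%:R) = (1 - x) ^+ count a s.
Proof.
elim: s => [|e s IH]; first by rewrite big_nil.
rewrite big_cons IH /= exprD.
by case: (a e); rewrite ?mulr1 // mulr0 subr0.
Qed.

(** Given the pairs away from [v], an arm needs one of [X] pairs at [v] to be open, which has
    probability [1 - (1 - p) ^+ X]. The tangent bound is linear in [X], so only expectations of the
    shorter arms enter, and no independence between them. *)
Lemma arm_step (R : realFieldType) (n : nat) (p b : R) (v : 'I_n) (k : nat) :
  0 <= p <= 1 -> p * n%:R <= 2 -> b <= 2 ->
  (forall u : 'I_n, expect p (fun G => (arm u k G)%:R) <= b) ->
  expect p (fun G => (arm v k.+1 G)%:R) <=
  (1 + p / 4 - b / 2) * (p * n%:R * b) + b ^+ 2 / 4.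
Proof.
move=> p01 pn b2 IH; have /andP[p0 p1] := p01.
pose a (e : vpair n) (G : graph n) :=
  [exists u : 'I_n, (val e == [set v; u]) && arm u k (G :\: star v)].
pose s := enum (star v); pose X G := count (a^~ G) s.
pose N G := (\sum_(u : 'I_n) arm u k G)%N.
have XN G : (X G <= N G)%N.
  rewrite /X -sum1_count big_mkcond /= /s big_enum /= big_mkcond /=.
  apply: (@leq_trans (\sum_(e : vpair n) \sum_(u : 'I_n)
    (val e == [set v; u]) * arm u k G)%N).
    apply: leq_sum => e _; case: ifP => // _; case: ifP => // /existsP[u].
    move=> /andP[evu armu]; rewrite (bigD1 u) //= evu.
    by rewrite (arm_increasing (subsetDl _ _) armu).
  rewrite exchange_big /= leq_sum // => u _.
  rewrite -big_distrl /= -[leqRHS]mul1n leq_mul2r; apply/orP; right.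
  rewrite -big_mkcond /= sum1_card; apply/card_le1_eqP => e e'.
  have valE (x : vpair n) : val x == [set v; u] -> val x = [set v; u] by move/eqP.
  by move=> /valE eE /valE eE'; apply: val_inj; rewrite eE eE'.
have Nn G : (N G <= n)%N.
  by rewrite -[leqRHS]card_ord -sum1_card leq_sum // => u _; case: arm.
have inda : {in s &, forall x e, independent_of x (a e)}.
  move=> x e; rewrite mem_enum inE => xv _ G.
  suff DE : (x |: G) :\: star v = (G :\ x) :\: star v by rewrite /a DE.
  by apply/setP => y; rewrite !inE; case: (eqVneq y x) => [->|//]; rewrite xv.
have c0 : 0 <= 1 + p / 4 - b / 2 by lra.
pose c := 1 + p / 4 - b / 2.
apply: (@le_trans _ _ (expect p (fun G => 1 + -1 *
    (\prod_(e <- s) (1 - ((e \in G) && a e G)%:R) * 1)))).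
  apply: ler_expect => // G; rewrite mulr1 mulN1r.
  case: (boolP (arm v k.+1 G)) => [/arm_recl[e [u [eG evu armu]]]|_] /=.
    have es : e \in s by rewrite mem_enum inE evu !inE eqxx.
    rewrite (big_rem _ es) /= eG /=.
    suff -> : a e G by rewrite subrr mul0r subr0.
    by apply/existsP; exists u; rewrite evu eqxx.
  rewrite subr_ge0; elim: (s) => [|e s' IHs]; first by rewrite big_nil.
  rewrite big_cons; case: (_ && _); first by rewrite subrr mul0r.
  by rewrite subr0 mul1r.
rewrite expectD expectZ expect_prod_independent ?enum_uniq //.
rewrite -expectZ -expectD.
(* The slope [c] is nonnegative, so [X] may be replaced by the larger [N], whose mean is at most
   [n%:R * b]. *)
apply: (@le_trans _ _ (expect p (fun G => b ^+ 2 / 4 + c * p * (N G)%:R))).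
  apply: ler_expect => // G; rewrite prod_exp_count mulr1 mulN1r -/(X G).
  have XnR : (X G)%:R <= n%:R :> R by rewrite ler_nat (leq_trans (XN G)).
  have pX : p * (X G)%:R <= 2 by apply: le_trans pn; apply: ler_wpM2l.
  apply: le_trans (one_sub_expr_le b p01 pX) _; rewrite lerD2l.
  by apply: ler_wpM2l; rewrite ?mulr_ge0 // ler_nat.
rewrite expectD expect_cst expectZ addrC lerD2r -/c.
rewrite -mulrA; apply: ler_wpM2l => //.
rewrite -mulrA; apply: ler_wpM2l => //.
rewrite (@eq_expect _ _ p _ (fun G => \sum_(u : 'I_n) (arm u k G)%:R)); last first.
  by move=> G; rewrite natr_sum.
rewrite expect_sum (le_trans (ler_sum _ (fun u _ => IH u))) //.
by rewrite sumr_const card_ord mulr_natl.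
Qed.

(** The critical recursion sends [b] to about [b - b ^+ 2 / 4], which decays like [4 / j]; the
    constant 6 leaves room for the drift from [eta] and [p] up to depth [k]. *)
Lemma arm_prob (R : realFieldType) (n : nat) (p eta : R) (k : nat) :
  0 <= p <= 1 -> 0 <= eta -> p * n%:R <= 1 + eta ->
  8 * k%:R * eta <= 1 -> 8 * k%:R * p <= 1 ->
  forall j (v : 'I_n), (j <= k)%N ->
    expect p (fun G => (arm v j G)%:R) <= 6 / (j%:R + 1).
Proof.
move=> p01 eta0 pn keta kp; have /andP[p0 p1] := p01.
have prob_le1 j (v : 'I_n) : expect p (fun G => (arm v j G)%:R) <= 1.
  rewrite -[leRHS](expect_cst (vpair n) p 1); apply: ler_expect => // G.
  by case: arm.
elim=> [|j IH] v jk.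
  by rewrite (le_trans (prob_le1 _ _)) // add0r divr1 ler1n.
(* For [j <= 4] the claimed bound [6 / (j.+1%:R + 1)] is at least 1. *)
case: (leqP j 4) => j4.
  apply: le_trans (prob_le1 _ _) _.
  have j4R : j%:R <= 4 :> R by rewrite (ler_nat _ _ 4).
  have j0R : 0 <= j%:R :> R by rewrite ler0n.
  by rewrite -[j.+1%:R]natr1 ler_pdivlMr; lra.
have j5 : 5 <= j%:R :> R by rewrite (ler_nat _ 5).
have jkR : j%:R + 1 <= k%:R :> R by rewrite natr1 ler_nat.
set J : R := j%:R + 1 in jkR *; have J6 : 6 <= J by rewrite /J; lra.
pose b : R := 6 / J.
have J0 : 0 < J by lra.
have bJ : b * J = 6 by rewrite /b divfK // gt_eqF.
have b0 : 0 <= b by rewrite /b divr_ge0 //; lra.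
have b1 : b <= 1 by rewrite /b ler_pdivrMr //; lra.
have p8 : 8 * J * p <= 1.
  by have := mulr_ge0 (_ : 0 <= k%:R - J) p0; rewrite subr_ge0 => /(_ jkR); lra.
have eta8 : 8 * J * eta <= 1.
  by have := mulr_ge0 (_ : 0 <= k%:R - J) eta0; rewrite subr_ge0 => /(_ jkR); lra.
have p_small : p <= 1 / 48.
  by have := mulr_ge0 (_ : 0 <= J - 6) p0; rewrite subr_ge0 => /(_ J6); lra.
have eta_small : eta <= 1 / 48.
  by have := mulr_ge0 (_ : 0 <= J - 6) eta0; rewrite subr_ge0 => /(_ J6); lra.
have pn2 : p * n%:R <= 2 by lra.
have b2 : b <= 2 by lra.
apply: le_trans (arm_step v p01 pn2 b2 (fun u => IH u (ltnW jk))) _.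
rewrite -[j.+1%:R]natr1 -/J.
apply: (@le_trans _ _ (b - b ^+ 2 / 4 + b * (eta + p / 2))).
  have c0 : 0 <= 1 + p / 4 - b / 2 by lra.
  have : (1 + p / 4 - b / 2) * (p * n%:R * b) <= (1 + p / 4 - b / 2) * ((1 + eta) * b).
    by apply: ler_wpM2l => //; apply: ler_wpM2r.
  have : 0 <= eta * b ^+ 2 by rewrite mulr_ge0 // sqr_ge0.
  have : 0 <= p * b * (1 - eta) by apply: mulr_ge0; [exact: mulr_ge0 | lra].
  lra.
rewrite ler_pdivlMr; last lra.
(* After multiplication by [J + 1], the gain [b ^+ 2 * J / 4 = 3 * b / 2] beats [b] plus two drift
   terms of at most [3 * b / 16] each; 3/16 is 1/8 from [eta] plus 1/16 from [p / 2]. *)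
have : 0 <= b * (3 / 16 - (eta + p / 2) * J) by apply: mulr_ge0 => //; lra.
have : 0 <= b * (3 / 16 - (eta + p / 2)) by apply: mulr_ge0 => //; lra.
have b2J : b ^+ 2 * J = 6 * b by rewrite expr2 -mulrA bJ mulrC.
have := sqr_ge0 b; lra.
Qed.

Lemma two_arms_prob (R : realFieldType) (n : nat) (p eta : R) (k : nat)
    (v : 'I_n) :
  (0 < k)%N -> 0 <= p <= 1 -> 0 <= eta -> p * n%:R <= 1 + eta ->
  8 * k%:R * eta <= 1 -> 8 * k%:R * p <= 1 ->
  expect p (fun G => (two_arms k v G)%:R) <= 36 / k%:R ^+ 2.
Proof.
move=> k0 p01 eta0 pn keta kp; have /andP[p0 p1] := p01.
have kR : 0 < k%:R :> R by rewrite ltr0n.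
apply: le_trans (BK_inequality p0 p1 (@arm_increasing n v k) (@arm_increasing n v k)) _.
have := arm_prob p01 eta0 pn keta kp v (leqnn k).
set t := expect _ _ => tk.
have t0 : 0 <= t by apply: expect_ge0 => // G; rewrite ler0n.
have tk' : t <= 6 / k%:R.
  apply: le_trans tk _; rewrite ler_pM2l // lef_pV2 ?posrE //; lra.
have -> : 36 / k%:R ^+ 2 = (6 / k%:R) * (6 / k%:R) :> R.
  by field; rewrite gt_eqF.
exact: ler_pM.
Qed.

(** * Vertex symmetry and the influence of a pair *)

Section Relabelling.
Variable n : nat.
Implicit Types (sigma : {perm 'I_n}) (e : vpair n) (G : graph n).

Fact relabel_subproof sigma e : #|sigma @: val e| == 2.
Proof. by rewrite card_imset ?(valP e) //; apply: perm_inj. Qed.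

Definition relabel sigma e : vpair n :=
  exist _ (sigma @: val e) (relabel_subproof sigma e).

Lemma relabelK sigma : cancel (relabel sigma) (relabel sigma^-1%g).
Proof.
move=> e; apply: val_inj; rewrite /= -imset_comp -[RHS]imset_id.
by apply: eq_imset => x /=; rewrite permK.
Qed.

Lemma relabelVK sigma : cancel (relabel sigma^-1%g) (relabel sigma).
Proof. by move=> e; rewrite -{1}(invgK sigma) relabelK. Qed.

Lemma relabel_bij sigma : bijective (relabel sigma).
Proof. exact: Bijective (relabelK sigma) (relabelVK sigma). Qed.

Lemma relabel_trans e e' : exists sigma, relabel sigma e = e'.
Proof.
have /cards2P[a [b [ab eE]]] := valP e.
have /cards2P[c [d [cd eE']]] := valP e'.
(* Once [a] is moved to [c], [b] sits at [b'], different from [c]; the second transposition then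
   moves [b'] to [d] and fixes [c]. *)
pose b' := tperm a c b.
have b'c : b' != c by rewrite /b' -[X in _ != X](tpermL a c) (inj_eq perm_inj) eq_sym.
exists (tperm a c * tperm b' d)%g; apply: val_inj.
rewrite /= eE eE' imsetU1 imset_set1 !permM tpermL -/b' tpermL tpermD //.
by rewrite eq_sym.
Qed.

Lemma arm_relabel sigma v k G :
  arm v k G -> arm (sigma v) k (relabel sigma @: G).
Proof.
move=> /existsP[s /andP[us ps]].
apply/existsP; exists (map_tuple sigma s); rewrite /=.
rewrite -[_ && uniq _]/(uniq (map sigma (v :: s))) (map_inj_uniq perm_inj) us.
rewrite path_map; apply: sub_path ps => x y /existsP[e /andP[eG /eqP exy]].
apply/existsP; exists (relabel sigma e); rewrite imset_f //=.
by rewrite exy imsetU1 imset_set1.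
Qed.

Lemma two_arms_relabel sigma k v G :
  two_arms k (sigma v) (relabel sigma @: G) = two_arms k v G.
Proof.
have relabelled (tau : {perm 'I_n}) u (K : graph n) : two_arms k u K ->
    two_arms k (tau u) (relabel tau @: K).
  move=> /existsP[W1 /existsP[W2 /and5P[W12 s1 s2 A1 A2]]].
  apply/existsP; exists (relabel tau @: W1).
  apply/existsP; exists (relabel tau @: W2).
  rewrite !imsetS // !arm_relabel // !andbT -setI_eq0 -imsetI.
    by rewrite (eqP (_ : W1 :&: W2 == set0)) ?imset0 // setI_eq0.
  by move=> x y _ _; apply: bij_inj (relabel_bij tau) _ _.
apply/idP/idP; last exact: relabelled.
move/(relabelled sigma^-1%g); rewrite permK -imset_comp.
by rewrite (eq_imset (g := id)) ?imset_id // => x /=; rewrite relabelK.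
Qed.

End Relabelling.

(** As [two_arms] is increasing, each summand is the probability that [e] is open and pivotal, i.e.
    [p] times the usual influence. *)
Definition influence (R : realFieldType) (n : nat) (p : R) (k : nat)
    (e : vpair n) : R :=
  \sum_v expect p (fun G => (e \in G)%:R *
    ((two_arms k v G)%:R - (two_arms k v (G :\ e))%:R)).

Lemma influence_relabel (R : realFieldType) (n : nat) (p : R) (k : nat)
    (sigma : {perm 'I_n}) (e : vpair n) :
  influence p k (relabel sigma e) = influence p k e.
Proof.
have inj := bij_inj (relabel_bij sigma).
rewrite /influence (reindex_inj (@perm_inj _ sigma)); apply: eq_bigr => v _.
rewrite (expect_reindex _ _ (relabel_bij sigma)); apply: eq_expect => G.
rewrite mem_imset // two_arms_relabel.
suff -> : (relabel sigma @: G) :\ relabel sigma e = relabel sigma @: (G :\ e).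
  by rewrite two_arms_relabel.
apply/setP => x; rewrite -(relabelVK sigma x) mem_imset // !inE mem_imset //.
by rewrite (inj_eq inj).
Qed.

Lemma card_vpair (n : nat) : (1 < n)%N -> (n * n <= 4 * #|{: vpair n}|)%N.
Proof.
move=> n1; have -> : #|{: vpair n}| = 'C(n, 2).
  by rewrite card_sig -[in RHS](card_ord n) -card_draws; apply: eq_card => A; rewrite !inE.
have := bin_ffact n 2; rewrite ffactnS ffactn1 (_ : 2`! = 2)%N //.
by move: 'C(n, 2) n1 => N; case: n => [|[|n]] //= _; nia.
Qed.

(** By symmetry each pair has the average influence. Every vertex contributes at most
    [2k * 36 / k^2 = 72 / k] in total, and there are at least [n^2 / 4] pairs, whence
    [288 = 4 * 72]. *)
Lemma influence_le (R : realFieldType) (n : nat) (p eta : R) (k : nat)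
    (e : vpair n) :
  (1 < n)%N ->
  (0 < k)%N -> 0 <= p <= 1 -> 0 <= eta -> p * n%:R <= 1 + eta ->
  8 * k%:R * eta <= 1 -> 8 * k%:R * p <= 1 ->
  influence p k e <= 288 / (k%:R * n%:R).
Proof.
move=> n1 k0 p01 eta0 pn keta kp; have /andP[p0 p1] := p01.
have kR : 0 < k%:R :> R by rewrite ltr0n.
have nR : 0 < n%:R :> R by rewrite ltr0n ltnW.
have infE (e' : vpair n) : influence p k e' = influence p k e.
  by have [sigma <-] := relabel_trans e e'; rewrite influence_relabel.
have total : #|{: vpair n}|%:R * influence p k e <= n%:R * (72 / k%:R).
  rewrite mulr_natl -sumr_const (eq_bigr (influence p k)) => [|e' _]; last by rewrite infE.
  rewrite /influence exchange_big /=.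
  apply: (@le_trans _ _ (\sum_(v : 'I_n) (72 / k%:R))); last first.
    by rewrite sumr_const card_ord [leRHS]mulr_natl.
  apply: ler_sum => v _; rewrite -expect_sum.
  apply: (@le_trans _ _ (expect p (fun G => (k + k)%:R * (two_arms k v G)%:R))).
    apply: ler_expect => // G; apply: sum_pivotal_le.
      exact: disjoint_occurrence_increasing.
    by apply: disjoint_occurrence_support; apply: arm_support.
  rewrite expectZ; have := two_arms_prob v k0 p01 eta0 pn keta kp.
  move=> /(ler_wpM2l (ler0n _ (k + k))) /le_trans; apply.
  rewrite natrD le_eqVlt; apply/orP; left; apply/eqP.
  by field; rewrite gt_eqF.
have := card_vpair n1; rewrite -(ler_nat R) !natrM => N4.
have [i0|i0] := leP (influence p k e) 0.
  by rewrite (le_trans i0) // divr_ge0 // mulr_ge0 // ltW.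
rewrite ler_pdivlMr ?mulr_gt0 //.
have : n%:R * n%:R * influence p k e <= 4 * (n%:R * (72 / k%:R)).
  apply: le_trans (_ : 4 * #|{: vpair n}|%:R * influence p k e <= _).
    by rewrite ler_pM2r.
  by rewrite -mulrA ler_pM2l.
have -> : 4 * (n%:R * (72 / k%:R)) = n%:R * (288 / k%:R) :> R by field; rewrite gt_eqF.
rewrite -mulrA ler_pM2l // ler_pdivlMr //; lra.
Qed.

(** * Covariance bound for adaptive exploration *)

(** Decoupling one coin changes the expectation by exactly [p * (1 - p) * (a1 - a0) * (f1 - f0)]. *)
Lemma resampling_cost (R : realFieldType) (p a1 a0 f1 f0 : R) :
  0 <= p -> p <= 1 -> 0 <= a1 <= 1 -> 0 <= a0 -> f0 <= f1 ->
  p * (a1 * f1) + (1 - p) * (a0 * f0) <=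
  p * (a1 * (p * f1 + (1 - p) * f0)) + (1 - p) * (a0 * (p * f1 + (1 - p) * f0))
  + p * (f1 - f0).
Proof.
move=> p0 p1 /andP[a10 a11] a00 f01.
have q0 : 0 <= 1 - p by lra.
have d0 : 0 <= f1 - f0 by lra.
have : 0 <= p * (f1 - f0) * (1 - a1) by rewrite !mulr_ge0 //; lra.
have : 0 <= p * (f1 - f0) * (a1 * p) by rewrite !mulr_ge0.
have : 0 <= (1 - p) * p * a0 * (f1 - f0) by rewrite !mulr_ge0.
lra.
Qed.

Section AdaptiveInfluence.
Variables (R : realFieldType) (n : nat) (p : R) (I : finType).
Variables (F : I -> graph n -> bool) (psi : I -> graph n -> R) (w : R).
Hypotheses (p_ge0 : 0 <= p) (p_le1 : p <= 1).
Hypothesis F_incr : forall i, increasing (F i).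
Hypothesis psi01 : forall i G, 0 <= psi i G <= 1.
Hypothesis w_ge0 : 0 <= w.
Hypothesis w_ub : forall e, \sum_i expect p (fun G =>
  (e \in G)%:R * ((F i G)%:R - (F i (G :\ e))%:R)) <= w.
Implicit Types (S H G : graph n) (t : strategy n) (e : vpair n).

(* [S] are the pairs that have already been queried, [H] those of them that
   turned out to be edges. *)
Let overwrite S H G := (G :\: S) :|: H.
Let outcome t S H G := H :|: revealed t (overwrite S H G).

Let overwriteU1 S H G e :
  e \notin S -> overwrite S H (e |: G) = overwrite (e |: S) (e |: H) G.
Proof.
move=> eS; apply/setP => x; rewrite !inE.
by case: (eqVneq x e) => [->|_] //=; rewrite (negbTE eS).
Qed.

Let overwriteD1 S H G e : overwrite S H (G :\ e) = overwrite (e |: S) H G.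
Proof.
apply/setP => x; rewrite !inE.
by case: (eqVneq x e) => [->|_] //=; rewrite ?andbF.
Qed.

Let overwrite_indep S H G K e :
  e \in S -> G :\ e = K :\ e -> overwrite S H G = overwrite S H K.
Proof.
move=> eS /setP GK; apply/setP => x; have := GK x; rewrite !inE.
by case: (eqVneq x e) => [->|_] /= => [_|->]; rewrite ?eS.
Qed.

Let outcome_old e t1 t0 S H G : H \subset S -> e \in S ->
  outcome (Query e t1 t0) S H G = outcome (if e \in H then t1 else t0) S H G.
Proof.
move=> HS eS; rewrite /outcome /revealed /=.
have -> : e \in overwrite S H G = (e \in H) by rewrite !inE eS.
apply/setP => x; rewrite !inE; case: (eqVneq x e) => [->|//].
by rewrite eS /=; case: (e \in H) => //=; rewrite !andbF.
Qed.

Let outcomeU1 e t1 t0 S H G : e \notin S ->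
  outcome (Query e t1 t0) S H (e |: G) = outcome t1 (e |: S) (e |: H) G.
Proof.
move=> eS; rewrite /outcome /revealed /= overwriteU1 //.
have -> : e \in overwrite (e |: S) (e |: H) G by rewrite !inE eqxx orbT.
apply/setP => x; rewrite !inE; case: (eqVneq x e) => [->|//] /=.
by rewrite orbT.
Qed.

Let outcomeD1 e t1 t0 S H G : H \subset S -> e \notin S ->
  outcome (Query e t1 t0) S H (G :\ e) = outcome t0 (e |: S) H G.
Proof.
move=> HS eS; rewrite /outcome /revealed /= overwriteD1.
have eH : e \notin H by apply: contra eS; apply: subsetP.
have -> : e \in overwrite (e |: S) H G = false.
  by rewrite !inE eqxx (negbTE eH).
apply/setP => x; rewrite !inE; case: (eqVneq x e) => [->|//] /=.
by rewrite (negbTE eH) !andbF.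
Qed.

Let expect_resample f e i :
  independent_of e f ->
  expect p (fun G => f G * (p * (F i (e |: G))%:R + (1 - p) * (F i (G :\ e))%:R))
  = expect p (fun G => f G * (F i G)%:R).
Proof.
move=> indf; rewrite [RHS](expect_split _ e) [LHS](expect_split _ e).
apply: eq_expect => G; rewrite indf !setUA setUid.
have -> : (e |: G) :\ e = G :\ e by apply/setP => x; rewrite !inE; case: eqVneq.
have -> : e |: G :\ e = e |: G by apply/setP => x; rewrite !inE; case: eqVneq.
have -> : G :\ e :\ e = G :\ e by apply/setP => x; rewrite !inE; case: eqVneq.
by ring.
Qed.

(** On the left the answer to the query and the event [F i] share the coin of [e]; in the first two
    terms on the right the event has a fresh copy. *)
Let resample_bound e i (a1 a0 : graph n -> R) :
  (forall G, 0 <= a1 G <= 1) -> (forall G, 0 <= a0 G) ->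
  independent_of e a1 -> independent_of e a0 ->
  expect p (fun G => p * (a1 G * (F i (e |: G))%:R) +
                     (1 - p) * (a0 G * (F i (G :\ e))%:R)) <=
  p * expect p (fun G => a1 G * (F i G)%:R) +
  (1 - p) * expect p (fun G => a0 G * (F i G)%:R) +
  expect p (fun G => (e \in G)%:R * ((F i G)%:R - (F i (G :\ e))%:R)).
Proof.
move=> a1P a0P ind1 ind0.
rewrite -(expect_resample i ind1) -(expect_resample i ind0).
rewrite [X in _ <= _ + X](expect_split _ e) -!expectZ -!expectD.
apply: ler_expect => // G.
have -> : (e |: G) :\ e = G :\ e by apply/setP => x; rewrite !inE; case: eqVneq.
rewrite setU11 setD11 mul0r mulr0 addr0 mul1r.
apply: resampling_cost => //; rewrite ler_nat.
case: (boolP (F i (G :\ e))) => // FG; rewrite (F_incr _ FG) //.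
by apply: subset_trans (subD1set _ _) (subsetUr _ _).
Qed.

(** Induction on the tree. [outcome] ignores [G] on [S], so there [F i G] reads fresh coins. Each
    new query decouples one more coin at total cost at most [w]; at a leaf the outcome is constant
    and the expectation factors. *)
Lemma adaptive_influence t S H m :
  H \subset S ->
  (forall G, (#|queried t (overwrite S H G) :\: S| <= m)%N) ->
  \sum_i expect p (fun G => psi i (outcome t S H G) * (F i G)%:R) <=
  \sum_i expect p (fun G => psi i (outcome t S H G)) *
         expect p (fun G => (F i G)%:R) + m%:R * w.
Proof.
elim: t S H m => [|e t1 IH1 t0 IH0] S H m HS qm.
  rewrite -[leLHS]addr0 lerD // ?mulr_ge0 //; apply: ler_sum => i _.
  have E G : psi i (outcome (@Stop n) S H G) = psi i H.
    by rewrite /outcome /revealed /= set0I setU0.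
  rewrite (@eq_expect _ _ p _ (fun G => psi i H * (F i G)%:R)) => [|G]; last by rewrite E.
  rewrite expectZ [X in _ <= X * _](@eq_expect _ _ p _ (fun=> psi i H)) //.
  by rewrite expect_cst.
(* A repeated query is answered from [H] and costs nothing. *)
have [eS|eS] := boolP (e \in S).
  pose t := if e \in H then t1 else t0.
  have IHt : \sum_i expect p (fun G => psi i (outcome t S H G) * (F i G)%:R) <=
    \sum_i expect p (fun G => psi i (outcome t S H G)) *
         expect p (fun G => (F i G)%:R) + m%:R * w.
    suff : forall G, (#|queried t (overwrite S H G) :\: S| <= m)%N.
      by rewrite /t; case: (e \in H); [apply: IH1 | apply: IH0].
    move=> G; apply: leq_trans (qm G); apply: subset_leq_card; apply: setSD.
    have eE : (e \in overwrite S H G) = (e \in H) by rewrite !inE eS.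
    by rewrite /= eE subsetUr.
  have E i : (fun G => psi i (outcome (Query e t1 t0) S H G)) =1
             (fun G => psi i (outcome t S H G)).
    by move=> G; rewrite outcome_old.
  rewrite (eq_bigr (fun i => expect p (fun G => psi i (outcome t S H G) * (F i G)%:R))); last first.
    by move=> i _; apply: eq_expect => G; rewrite E.
  rewrite [X in _ <= X + _](eq_bigr (fun i => expect p (fun G => psi i (outcome t S H G)) *
         expect p (fun G => (F i G)%:R))) // => i _.
  by rewrite (eq_expect _ (E i)).
have e1 : e \in e |: S by rewrite setU11.
have HS1 : e |: H \subset e |: S by apply: setUS.
have HS0 : H \subset e |: S by apply: subset_trans HS (subsetUr _ _).
(* [e] itself is a new query of the whole tree but not of the subtree, so the budget drops by
   one. *)
have qG G t' : queried (Query e t1 t0) (overwrite S H G) = e |: queried t' (overwrite S H G) ->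
    (#|queried t' (overwrite S H G) :\: (e |: S)| < m)%N.
  move=> qE; apply: leq_trans (qm G); rewrite qE; apply: proper_card.
  apply/properP; split; first by apply/subsetP => x; rewrite !inE negb_or => /andP[/andP[_ ->] ->]; rewrite orbT.
  by exists e; rewrite !inE eqxx ?eS.
have m0 : (0 < m)%N.
  apply: leq_ltn_trans (leq0n _) (qG setT (if e \in overwrite S H setT then t1 else t0) _).
  by [].
have q1 G : (#|queried t1 (overwrite (e |: S) (e |: H) G) :\: (e |: S)| <= m.-1)%N.
  rewrite -ltnS prednK // -overwriteU1 //; apply: qG => /=.
  by rewrite !inE eqxx (negbTE eS).
have q0 G : (#|queried t0 (overwrite (e |: S) H G) :\: (e |: S)| <= m.-1)%N.
  rewrite -ltnS prednK // -overwriteD1 //; apply: qG => /=.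
  have eH : e \notin H by apply: contra eS; apply: subsetP.
  by rewrite !inE eqxx (negbTE eH) andbF.
pose a1 i G := psi i (outcome t1 (e |: S) (e |: H) G).
pose a0 i G := psi i (outcome t0 (e |: S) H G).
have ind t' K (i : I) : independent_of e (fun G => psi i (outcome t' (e |: S) K G)).
  move=> G; rewrite /outcome (@overwrite_indep _ _ (e |: G) (G :\ e) e) //.
  by apply/setP => x; rewrite !inE; case: eqVneq.
have {}IH1 := IH1 _ _ _ HS1 q1; have {}IH0 := IH0 _ _ _ HS0 q0.
have bound i := resample_bound i (fun G => psi01 i (outcome t1 (e |: S) (e |: H) G))
   (fun G => proj1 (andP (psi01 i (outcome t0 (e |: S) H G))))
   (ind t1 (e |: H) i) (ind t0 H i).
apply: le_trans (_ : \sum_i (p * expect p (fun G => a1 i G * (F i G)%:R) +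
  (1 - p) * expect p (fun G => a0 i G * (F i G)%:R) +
  expect p (fun G => (e \in G)%:R * ((F i G)%:R - (F i (G :\ e))%:R))) <= _).
  apply: ler_sum => i _; rewrite (expect_split _ e).
  apply: le_trans (bound i); rewrite le_eqVlt; apply/orP; left; apply/eqP.
  by apply: eq_expect => G; rewrite outcomeU1 // outcomeD1.
rewrite !big_split /= -!mulr_sumr.
have mE : m%:R = m.-1%:R + 1 :> R by rewrite natr1 prednK.
have sumE : \sum_i expect p (fun G => psi i (outcome (Query e t1 t0) S H G)) *
    expect p (fun G => (F i G)%:R) =
  p * (\sum_i expect p (a1 i) * expect p (fun G => (F i G)%:R)) +
  (1 - p) * (\sum_i expect p (a0 i) * expect p (fun G => (F i G)%:R)).
  rewrite !mulr_sumr -big_split; apply: eq_bigr => i _ /=.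
  rewrite !mulrA -mulrDl; congr (_ * _).
  rewrite -!expectZ -expectD (expect_split _ e).
  by apply: eq_expect => G; rewrite outcomeU1 // outcomeD1.
rewrite sumE mE [X in _ <= _ + X]mulrDl mul1r [leRHS]addrA; apply: lerD; last exact: w_ub.
apply: le_trans (lerD (ler_wpM2l p_ge0 IH1) (ler_wpM2l (_ : 0 <= 1 - p) IH0)) _.
  by rewrite subr_ge0.
rewrite le_eqVlt; apply/orP; left; apply/eqP.
by rewrite /a1 /a0; ring.
Qed.

End AdaptiveInfluence.

(** * From a long path to many vertices with two arms *)

Lemma adj_sym (n : nat) (G : graph n) : symmetric (adj G).
Proof. by move=> u v; rewrite /adj setUC. Qed.

(** Restricting to pairs inside the vertex set of the path lets the two sides of a longer path have
    disjoint witnesses. *)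
Lemma arm_of_path (n : nat) (G : graph n) (v : 'I_n) (s : seq 'I_n) (k : nat) :
  uniq (v :: s) -> path (adj G) v s -> (k <= size s)%N ->
  arm v k [set e in G | val e \subset v :: s].
Proof.
move=> us ps ks; have size_take : size (take k s) == k.
  by rewrite size_takel.
apply/existsP; exists (Tuple size_take); apply/andP; split.
  change (uniq (v :: take k s)).
  have : uniq ((v :: take k s) ++ drop k s) by rewrite cat_cons cat_take_drop.
  by rewrite cat_uniq => /andP[].
apply: take_path; apply: (@sub_in_path _ (mem (v :: s)) (adj G)) ps; last by apply/allP.
move=> x y xs ys /existsP[e /andP[eG /eqP exy]].
apply/existsP; exists e; rewrite exy eqxx andbT inE eG exy /=.
by apply/subsetP => z; rewrite !inE => /orP[/eqP->|/eqP->].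
Qed.

Lemma two_arms_of_path (n : nat) (G : graph n) (v : 'I_n) (s1 s2 : seq 'I_n)
    (k : nat) :
  uniq (s1 ++ v :: s2) -> sorted (adj G) (s1 ++ v :: s2) ->
  (k <= size s1)%N -> (k <= size s2)%N -> two_arms k v G.
Proof.
move=> us ss k1 k2.
have [us1 ps1] : uniq (v :: rev s1) /\ path (adj G) v (rev s1).
  have ur : uniq (rev (s1 ++ v :: s2)) by rewrite rev_uniq.
  have sr : sorted (adj G) (rev (s1 ++ v :: s2)).
    rewrite rev_sorted; apply: sub_sorted ss => x y.
    by rewrite adj_sym.
  move: ur sr; rewrite rev_cat rev_cons cat_rcons => ur sr.
  by move: ur; rewrite cat_uniq => /and3P[_ _ ->]; case: (cat_sorted2 sr).
have us2 : uniq (v :: s2) by move: us; rewrite cat_uniq => /and3P[].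
have ps2 : path (adj G) v s2 by case: (cat_sorted2 ss).
apply/existsP; exists [set e in G | val e \subset v :: rev s1].
apply/existsP; exists [set e in G | val e \subset v :: s2].
rewrite !arm_of_path ?size_rev // !andbT; apply/and3P; split.
- rewrite -setI_eq0; apply/eqP/setP => e; rewrite !inE.
  apply/negP => /andP[/andP[_ /subsetP e1] /andP[_ /subsetP e2]].
  (* The two sides share only the vertex [v], so a pair inside both would lie in [[set v]]. *)
  suff : (#|val e| <= 1)%N by rewrite (eqP (valP e)).
  apply: (@leq_trans #|[set v]|); last by rewrite cards1.
  apply: subset_leq_card; apply/subsetP => x xe.
  have := e1 x xe; have := e2 x xe; rewrite !inE mem_rev.
  case: eqVneq => //= _ x2 x1; move: us; rewrite cat_uniq => /and3P[_ /hasP[]].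
  by exists x; rewrite ?inE ?x2 ?orbT.
- by apply/subsetP => e; rewrite inE => /andP[].
- by apply/subsetP => e; rewrite inE => /andP[].
Qed.

Lemma has_path_two_arms (n : nat) (G : graph n) (l k : nat) :
  has_path G l -> (l - 2 * k <= \sum_v two_arms k v G)%N.
Proof.
move=> /existsP[s /andP[us ss]].
(* The vertices with at least [k] path vertices on either side. *)
pose u := drop k (take (l - k) s).
have size_u : size u = (l - 2 * k)%N.
  by rewrite size_drop size_takel ?size_tuple; lia.
have uu : uniq u by rewrite drop_uniq // take_uniq.
rewrite -size_u -(card_uniqP uu) -sum1_card big_mkcond leq_sum //= => x _.
case: ifP => // /(nthP x)[j]; rewrite size_u => ju <-.
rewrite nth_drop nth_take; last by lia.
set v := nth x s (k + j).
have kj : (k + j < size s)%N by rewrite size_tuple; lia.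
rewrite (_ : two_arms k v G) //.
apply: (@two_arms_of_path _ _ _ (take (k + j) s) (drop (k + j).+1 s)).
- by rewrite -drop_nth // cat_take_drop.
- by rewrite -drop_nth // cat_take_drop.
- by rewrite size_takel ?leq_addr // ltnW.
- by rewrite size_drop size_tuple; lia.
Qed.

Lemma has_path_leq (n : nat) (G : graph n) (l : nat) :
  has_path G l -> (l <= n)%N.
Proof.
move=> /existsP[s /andP[us _]].
by rewrite -(size_tuple s) -(card_uniqP us) -[leqRHS]card_ord max_card.
Qed.

(** * Query bounds for strategies and algorithms, and the choice of constants *)

Lemma strategy_bound (R : realFieldType) (n : nat) (p eta : R) (k l m : nat)
    (t : strategy n) :
  (1 < n)%N -> (9 <= k)%N -> (4 * k <= l)%N ->
  0 <= p <= 1 -> 0 <= eta -> p * n%:R <= 1 + eta ->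
  8 * k%:R * eta <= 1 -> 8 * k%:R * p <= 1 ->
  (forall G, (#|queried t G| <= m)%N) ->
  expect p (fun G => (has_path (revealed t G) l)%:R) * (l%:R * k%:R * n%:R) <=
  1152 * m%:R.
Proof.
move=> n1 k9 kl p01 eta0 pn keta kp qm; have /andP[p0 p1] := p01.
have k0 : (0 < k)%N by apply: leq_trans k9.
have kR : 9 <= k%:R :> R by rewrite (ler_nat _ 9).
have nR : 0 < n%:R :> R by rewrite ltr0n ltnW.
pose F (v : 'I_n) := two_arms k v.
pose w : R := 288 / (k%:R * n%:R).
have w0 : 0 <= w by rewrite divr_ge0 // mulr_ge0 // ler0n.
pose Z : R := \sum_v expect p (fun G => (F v (revealed t G))%:R).
have F_incr v : increasing (F v) by apply: disjoint_occurrence_increasing.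
(* The covariance bound is applied with [psi] equal to [F]: since [revealed t G] is contained in
   [G], the product of the two indicators is the first one, and the left-hand side is [Z]. *)
have Zw : Z <= 2 * (m%:R * w).
  have := @adaptive_influence R n p _ F (fun v G => (F v G)%:R) w p0 p1 F_incr
    _ w0 (fun e => influence_le e n1 k0 p01 eta0 pn keta kp) t set0 set0 m.
  have over (G : graph n) : (G :\: set0) :|: set0 = G by rewrite setD0 setU0.
  rewrite (eq_bigr (fun v => expect p (fun G => (F v (revealed t G))%:R))); last first.
    move=> v _; apply: eq_expect => G; rewrite set0U over.
    case: (boolP (F v (revealed t G))) => [FG|_]; last by rewrite mul0r.
    by rewrite (F_incr _ _ _ _ FG) ?mul1r // subsetIr.
  move=> H; have {}H : Z <= \sum_v expect p (fun G => (F v (revealed t G))%:R) *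
      expect p (fun G => (F v G)%:R) + m%:R * w.
    rewrite (eq_bigr (fun v => expect p (fun G =>
      (F v (set0 :|: revealed t ((G :\: set0) :|: set0)))%:R) *
      expect p (fun G => (F v G)%:R))).
      apply: H => //; first by move=> v G; case: (F v G); rewrite ?lexx ?ler01.
      by move=> G; rewrite over setD0.
    move=> v _; congr (_ * _); apply: eq_expect => G.
    by rewrite set0U over.
  (* [36 / k^2 <= 1/2] because [k >= 9], so the product term is absorbed into half of [Z]. *)
  suff : \sum_v expect p (fun G => (F v (revealed t G))%:R) *
      expect p (fun G => (F v G)%:R) <= Z / 2 by move: H; lra.
  rewrite /Z mulr_suml; apply: ler_sum => v _; apply: ler_wpM2l.
    by apply: expect_ge0 => // G; rewrite ler0n.
  apply: le_trans (two_arms_prob v k0 p01 eta0 pn keta kp) _.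
  rewrite ler_pdivrMr; last by rewrite exprn_gt0 //; lra.
  by rewrite expr2; nra.
(* [4k <= l] gives [l - 2k >= l / 2]. *)
have PZ : expect p (fun G => (has_path (revealed t G) l)%:R) * (l%:R / 2) <= Z.
  rewrite mulrC -expectZ /Z -expect_sum; apply: ler_expect => // G.
  case: (boolP (has_path _ _)) => [hp|_]; last first.
    by rewrite mulr0 sumr_ge0 // => v _; rewrite ler0n.
  rewrite mulr1 -natr_sum.
  apply: le_trans (_ : (l - 2 * k)%:R <= _); last first.
    by rewrite ler_nat; apply: has_path_two_arms.
  by rewrite ler_pdivrMr // -natrM ler_nat; move: kl; clear; lia.
have kn0 : 0 < k%:R * n%:R :> R by rewrite mulr_gt0 //; lra.
have := le_trans PZ Zw; rewrite -(ler_pM2r kn0).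
have -> : 2 * (m%:R * w) * (k%:R * n%:R) = 576 * m%:R.
  by rewrite /w; field; apply/andP; split; rewrite gt_eqF //; lra.
move: (expect _ _) => P; lra.
Qed.

Lemma algorithm_bound (R : realType) (n : nat) (p eta q : R) (k l : nat)
    (A : algorithm R n) :
  (1 < n)%N -> (9 <= k)%N -> (4 * k <= l)%N ->
  0 <= p <= 1 -> 0 <= eta -> p * n%:R <= 1 + eta ->
  8 * k%:R * eta <= 1 -> 8 * k%:R * p <= 1 ->
  q <= prob_reveals_path p A l ->
  q * (l%:R * k%:R * n%:R) <= 1152 * (num_queries A)%:R.
Proof.
move=> n1 k9 kl p01 eta0 pn keta kp qA.
pose P (s : seed A) : R := expect p (fun G => (has_path (revealed (strategy_of s) G) l)%:R).
pose C : R := l%:R * k%:R * n%:R.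
have bound (s : seed A) : 0 < seed_law s -> P s * C <= 1152 * (num_queries A)%:R.
  move=> law0; apply: (strategy_bound n1 k9 kl p01 eta0 pn keta kp).
  move=> G; apply: leq_trans (leq_bigmax_cond _ law0).
  exact: (leq_bigmax G).
rewrite -/C; move: (1152 * _) bound => B bound.
apply: (@le_trans _ _ (\sum_(s : seed A) seed_law s * B)); last first.
  by rewrite -mulr_suml seed_law_sum1 mul1r.
apply: le_trans (_ : \sum_(s : seed A) seed_law s * (P s * C) <= _).
  rewrite (eq_bigr (fun s => seed_law s * P s * C)) => [|s _]; last by rewrite mulrA.
  rewrite -mulr_suml; apply: ler_wpM2r; first by rewrite !mulr_ge0 ?ler0n.
  apply: le_trans qA _; apply: ler_sum => s _.
  rewrite -mulr_sumr; apply: ler_wpM2l; first exact: seed_law_ge0.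
  rewrite big_mkcond /=; apply: ler_sum => G _.
  by case: (has_path _ _); rewrite ?mulr1 ?mulr0.
(* [num_queries] ignores seeds of probability zero, which carry no weight here. *)
apply: ler_sum => s _; have [law0|law0] := leP (seed_law s) 0.
  have -> : seed_law s = 0 by apply/eqP; rewrite eq_le law0 seed_law_ge0.
  by rewrite !mul0r.
by apply: ler_wpM2l; [exact: ltW | exact: bound].
Qed.

Theorem theorem1p2 (R : realType) :
  exists c : R, 0 < c /\
  forall delta q : R, 0 < delta <= 1 -> 0 <= q <= 1 ->
  exists (n0 : nat) (eps0 : R), 0 < eps0 /\
  forall (eps : R) (n l : nat),
    0 < eps < eps0 -> (n0 <= n)%N -> delta / eps <= l%:R ->
    let p := (1 + eps) / n%:R in
    forall A : algorithm R n,
      q <= prob_reveals_path p A l ->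
      c * (q * l%:R * delta / (p * eps)) <= (num_queries A)%:R.
Proof.
(* The final estimate loses a factor [1152 * 32 = 36864], which is below 40000. *)
exists (200 * 200)^-1; split; first by rewrite invr_gt0 mulr_gt0.
move=> delta q /andP[delta0 delta1] /andP[q0 q1].
(* [eps < delta / 160] makes [x] below at least 10, hence [k >= 9]. Any [n] that can hold the path
   satisfies [n >= l >= 16k], so it is large enough by itself. *)
exists 0%N, (delta / 160); split; first by rewrite divr_gt0.
move=> eps n l /andP[eps0 eps_lt] _ l_ge p A qA.
have [l_le_n|n_lt_l] := leqP l n; last first.
  have {}qA : q <= 0.
    apply: le_trans qA _; rewrite /prob_reveals_path big1 // => s _.
    by apply: big1 => G /has_path_leq; rewrite leqNgt n_lt_l.
  have -> : q = 0 by apply/eqP; rewrite eq_le qA.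
  by rewrite !mul0r mulr0 ler0n.
pose x : R := delta / (16 * eps).
have x10 : 10 <= x by rewrite /x ler_pdivlMr; lra.
have x_eps : x * eps = delta / 16 by rewrite /x; field; rewrite gt_eqF.
have l_x : 16 * x <= l%:R.
  apply: le_trans l_ge; rewrite le_eqVlt; apply/orP; left; apply/eqP.
  by rewrite /x; field; rewrite gt_eqF.
(* The arm length is [delta / (16 * eps)] rounded down: then [16k <= l], and
   [8 * k * eps <= delta / 2]. *)
pose k := Num.truncn x.
have /andP[kx xk] : k%:R <= x < k.+1%:R by apply: truncn_itv; lra.
have {}xk : x < k%:R + 1 by rewrite natr1.
have k9 : (9 <= k)%N by rewrite -ltnS -(ltr_nat R) -[k.+1%:R]natr1; lra.
have kl : (16 * k <= l)%N by rewrite -(ler_nat R) natrM; lra.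
have kn_nat : (16 * k <= n)%N := leq_trans kl l_le_n.
have n1 : (1 < n)%N by move: k9 kn_nat; clear; lia.
have nR : 0 < n%:R :> R by rewrite ltr0n ltnW.
have kn : 16 * k%:R <= n%:R :> R by rewrite -natrM ler_nat.
have kR : 9 <= k%:R :> R by rewrite (ler_nat _ 9).
have pn : p * n%:R = 1 + eps by rewrite /p divfK // gt_eqF.
have p0 : 0 < p by rewrite divr_gt0 //; lra.
have kp : 8 * k%:R * p <= 1.
  rewrite /p mulrA ler_pdivrMr // mul1r; apply: le_trans kn.
  have : 0 <= k%:R * (1 - eps) by apply: mulr_ge0; lra.
  lra.
have p1 : p <= 1.
  have : 0 <= (k%:R - 9) * p by apply: mulr_ge0; lra.
  lra.
have keps : 8 * k%:R * eps <= 1.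
  have : 0 <= (x - k%:R) * eps by apply: mulr_ge0; lra.
  lra.
have p01 : 0 <= p <= 1 by rewrite ltW.
pose Q : R := (num_queries A)%:R.
have k4 : (4 * k <= l)%N by apply: leq_trans kl; rewrite leq_mul2r orbT.
have pn1 : p * n%:R <= 1 + eps by rewrite pn.
have main := algorithm_bound n1 k9 k4 p01 (ltW eps0) pn1 keps kp qA.
rewrite -/Q in main.
have l0 : 0 <= l%:R :> R by rewrite ler0n.
have Q0 : 0 <= Q by rewrite ler0n.
have q_l : 0 <= q * l%:R by apply: mulr_ge0.
(* Rounding down loses less than 1, hence at most half of [x]. *)
have keps_ge : delta / 32 <= k%:R * eps.
  have : 0 <= (2 * k%:R - x) * eps by apply: mulr_ge0; lra.
  lra.
have npeps : k%:R * n%:R * (p * eps) = k%:R * eps * (1 + eps).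
  by rewrite -pn; ring.
have pe0 : 0 < p * eps := mulr_gt0 p0 eps0.
rewrite mulrA ler_pdivrMr // -/Q.
have : q * l%:R * (delta / 32) <= 1152 * (Q * (p * eps)).
  rewrite [leRHS]mulrA.
  apply: le_trans (_ : q * (l%:R * k%:R * n%:R) * (p * eps) <= _); last first.
    exact: ler_wpM2r (ltW pe0) _ _ main.
  have -> : q * (l%:R * k%:R * n%:R) * (p * eps) =
      q * l%:R * (k%:R * n%:R * (p * eps)) by ring.
  rewrite npeps; apply: ler_wpM2l => //; apply: le_trans keps_ge _.
  by rewrite ler_peMr ?mulr_ge0 //; lra.
have : 0 <= Q * (p * eps) by apply: mulr_ge0 => //; apply: ltW.
rewrite ler_pdivrMl ?mulr_gt0 //.
move: (Q * (p * eps)) (q * l%:R) => y z; lra.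
Qed.
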